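(* Let $p\geq 2$ and let $T:F_1\to F_2$ be a bounded finite rank linear operator between real Banach spaces $F_1$ and $F_2$. Then the $p$-summing norm of $T$ satisfies $$\pi_p(T)\leq 2\sqrt{e}\,\sqrt{\frac{\mathrm{rk}(T)+p}{p}}\;\|T\|,$$ where $\mathrm{rk}(T)$ is the rank of $T$ and $\|T\|$ its operator norm.
   Context: For a linear operator $T:F_1\to F_2$ between Banach spaces, $\pi_p(T)$ (the $p$-summing, or $p$-absolutely summing, norm of $T$) is the smallest constant $\alpha$ such that for all $m\geq 1$ and all $x_1,\ldots,x_m\in F_1$, $$\left(\sum_{i=1}^m\|Tx_i\|^p\right)^{1/p}\leq\alpha\sup_{x^*\in F_1^*,\,\|x^*\|\leq 1}\left(\sum_{i=1}^m|x^*(x_i)|^p\right)^{1/p}.$$ *)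

(* Defs.v *)
From HB Require Import structures.
From mathcomp Require Import all_boot all_order all_algebra.
From mathcomp Require Import all_classical all_reals all_analysis.
Set Implicit Arguments.
Unset Strict Implicit.
Unset Printing Implicit Defensive.
Import Order.TTheory GRing.Theory Num.Theory.
Import numFieldNormedType.Exports.
Local Open Scope classical_set_scope.
Local Open Scope ring_scope.

Definition opnorm (R : realType) (V W : normedModType R)
    (T : {linear V -> W}) : \bar R :=
  ereal_sup [set `|T x|%:E | x in [set x : V | `|x| <= 1]].

(* R^o is R as a normed module over itself, hence the functionals below are the
   elements of the topological dual. *)
Definition dual_unit_ball (R : realType) (V : normedModType R) :
    set {linear V -> R^o} :=
  [set f : {linear V -> R^o} | bounded_fun_norm f /\ (opnorm f <= 1)%E].

Definition lp_norm (R : realType) (W : normedModType R) (p : R) (m : nat)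
    (y : 'I_m -> W) : R :=
  (\sum_(i < m) `|y i| `^ p) `^ p^-1.

Definition weak_lp_norm (R : realType) (V : normedModType R) (p : R) (m : nat)
    (x : 'I_m -> V) : \bar R :=
  ereal_sup [set (lp_norm p (fun i => f (x i)))%:E
            | f in @dual_unit_ball R V].

Definition summing_bound (R : realType) (V W : normedModType R) (p : R)
    (T : {linear V -> W}) (a : R) : Prop :=
  forall (m : nat) (x : 'I_m -> V), (1 <= m)%N ->
    ((lp_norm p (fun i => T (x i)))%:E <= a%:E * weak_lp_norm p x)%E.

(* The infimum is a minimum whenever it is finite, the set of admissible
   constants being closed; it is +oo if T is not p-summing. The condition
   0 <= a matters only when V is the zero space. *)
Definition summing_norm (R : realType) (V W : normedModType R) (p : R)
    (T : {linear V -> W}) : \bar R :=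
  ereal_inf [set a%:E | a in [set a : R | 0 <= a /\ summing_bound p T a]].

Definition lin_indep (R : realType) (V : lmodType R) (n : nat)
    (v : 'I_n -> V) : Prop :=
  forall c : 'I_n -> R, \sum_(i < n) c i *: v i = 0 -> forall i, c i = 0.

Definition lin_span (R : realType) (V : lmodType R) (n : nat)
    (v : 'I_n -> V) : set V :=
  range (fun c : 'I_n -> R => \sum_(i < n) c i *: v i).

(* MathComp's vector-space dimension is restricted to finite-dimensional ambient
   spaces (vectType), hence this notion for subspaces of an arbitrary module. *)
Definition has_dim (R : realType) (V : lmodType R) (A : set V) (n : nat) :
    Prop :=
  exists v : 'I_n -> V, lin_indep v /\ lin_span v = A.

Definition finite_rank (R : realType) (V W : lmodType R)
    (T : {linear V -> W}) : Prop :=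
  exists n : nat, has_dim (range T) n.

(* The number n with has_dim (range T) n is unique; the value is irrelevant
   when T does not have finite rank. *)
Definition rk (R : realType) (V W : lmodType R) (T : {linear V -> W}) : nat :=
  get [set n | has_dim (range T) n].

(* Main.v *)
Require Import Defs.
From HB Require Import structures.
From mathcomp Require Import all_boot all_order all_algebra.
From mathcomp Require Import all_classical all_reals all_analysis.
From mathcomp Require Import ring lra.
Import Order.TTheory GRing.Theory Num.Theory.
Import numFieldNormedType.Exports.
Local Open Scope classical_set_scope.
Local Open Scope ring_scope.
Set Implicit Arguments.
Unset Strict Implicit.
Unset Printing Implicit Defensive.

(** The idea is to linearise even powers of functionals by polynomials. Let n be
    the rank of T and k the integer part of p / 2, so that k >= 1 and
    2k <= p <= 4k. The functionals g o T, for g on the range of T, are linear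
    forms <t, c(x)> in the n coordinates c(x) of T x. Given points x_i and
    weights w_i >= 0, the vectors (<t, c(x_i)>^k)_i all lie in one space U of
    dimension at most D = 'C(n + k, k), because <t, c>^k is a linear combination
    of monomials of degree k in c ([monomial_rowspace]). The orthogonal
    projection onto U rescaled by the sqrt(w_i) has trace at most D, and its
    diagonal entries K_i satisfy
      w_i <t, c(x_i)>^(2k) <= K_i \sum_l w_l <t, c(x_l)>^(2k)
    for every t ([rowspace_leverage], [power_leverage]).

    For each i take for <t, c(.)> a functional f_i with f_i (x_i) = |T x_i| and
    |f_i| <= |T .|; since the range of T is finite dimensional, it comes from
    the one-step Hahn-Banach extension, iterated ([norming_family],
    [finite_rank_norming]). With w_i = |T x_i|^(p - 2k), Hoelder's inequality
    bounds the sum on the right by S^(1 - 2k/p) (|T| M)^(2k), where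
    S = \sum_i |T x_i|^p and M is the weak l_p norm of (x_i). Summing over i
    gives S^(2k/p) <= D (|T| M)^(2k), and the stated constant follows from
    D <= (e (n + k) / k)^k <= (4 e (n + p) / p)^k ([binomial_expR_le]). *)

(** * Leverage scores of powers of linear forms *)

Lemma sum_CauchySchwarz (R : realFieldType) (m : nat) (a b : 'I_m -> R) :
  (\sum_i a i * b i) ^+ 2 <= (\sum_i a i ^+ 2) * \sum_i b i ^+ 2.
Proof.
set A := \sum_i a i ^+ 2; set B := \sum_i b i ^+ 2; set C := \sum_i a i * b i.
have A0 : 0 <= A by apply: sumr_ge0 => i _; exact: sqr_ge0.
have [A_eq0|A_neq0] := eqVneq A 0.
  suff -> : C = 0 by rewrite expr0n A_eq0 mul0r.
  apply: big1 => i _; suff /eqP : a i ^+ 2 = 0.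
    by rewrite sqrf_eq0 => /eqP ->; rewrite mul0r.
  by apply: (psumr_eq0P _ A_eq0) => // j _; exact: sqr_ge0.
have : 0 <= \sum_i (A * b i - C * a i) ^+ 2.
  by apply: sumr_ge0 => i _; exact: sqr_ge0.
have -> : \sum_i (A * b i - C * a i) ^+ 2 = A * (A * B - C ^+ 2).
  rewrite (eq_bigr (fun i => A ^+ 2 * b i ^+ 2 +
    (C ^+ 2 * a i ^+ 2 - 2 * A * C * (a i * b i)))); last by move=> i _; ring.
  rewrite big_split sumrB -!mulr_sumr -/A -/B -/C /=; ring.
by rewrite pmulr_rge0 ?subr_ge0// lt_def A_neq0.
Qed.

(** The numbers K_i are the diagonal entries of the orthogonal projection P onto
    the row space of A: u_i = <u, P e_i> for u in that space, |P e_i|^2 = P_ii,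
    and the trace of P is its rank. *)
Lemma rowspace_leverage (R : realFieldType) (N m : nat) (A : 'M[R]_(N, m)) :
  exists K : 'I_m -> R, (forall i, 0 <= K i) /\ \sum_i K i <= N%:R /\
    forall u : 'rV[R]_m, (u <= A)%MS ->
      forall i, u 0 i ^+ 2 <= K i * \sum_j u 0 j ^+ 2.
Proof.
move: (eq_row_base A) (row_base_free A); move: (row_base A) => B eqBA B_free.
pose G := B *m B^T.
(* Over a real field the Gram matrix of linearly independent rows is
   invertible. *)
have G_unit : G \in unitmx.
  rewrite -row_free_unit -kermx_eq0; apply/rowV0P => v /sub_kermxP vG0.
  have vB0 : v *m B = 0.
    have : (v *m B) *m (v *m B)^T = 0.
      by rewrite trmx_mul mulmxA -(mulmxA v) vG0 mul0mx.
    move/matrixP => /(_ 0 0); rewrite !mxE => s0.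
    apply/rowP => j; rewrite [RHS]mxE; apply/eqP; rewrite -sqrf_eq0; apply/eqP.
    have {}s0 : \sum_k (v *m B) 0 k ^+ 2 = 0.
      by apply: (etrans _ s0); apply: eq_bigr => k _;
        rewrite [X in _ * X]mxE expr2.
    by apply: (psumr_eq0P _ s0) => // k _; exact: sqr_ge0.
  by apply: (row_free_inj B_free); rewrite vB0 mul0mx.
pose P := B^T *m invmx G *m B.
have PT : P^T = P.
  rewrite /P !trmx_mul trmxK trmx_inv /G trmx_mul trmxK; exact: mulmxA.
have BP : B *m P = B by rewrite /P !mulmxA -/G mulmxV// mul1mx.
have PP : P *m P = P by rewrite {1}/P -mulmxA BP.
have diagP i : P i i = \sum_j P j i ^+ 2.
  rewrite -{1}PP mxE; apply: eq_bigr => j _.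
  by rewrite -{1}PT mxE expr2.
exists (fun i => P i i); split; last split.
- by move=> i; rewrite diagP; apply: sumr_ge0 => j _; exact: sqr_ge0.
- have -> : \sum_i P i i = \tr P by [].
  by rewrite /P -mulmxA mxtrace_mulC -mulmxA -/G mulVmx// mxtrace1
    ler_nat rank_leq_row.
move=> u; rewrite -eqBA => /submxP[w uE] i.
have uP : u *m P = u by rewrite uE -mulmxA BP.
by rewrite diagP mulrC -{1}uP mxE; exact: sum_CauchySchwarz.
Qed.

(** The k-th powers of the linear forms in n + 1 variables span, as functions of
    the points c_i, a space of dimension at most 'C(k + n, k): the rows of A are
    the monomials of degree k, indexed by the sorted k-tuples of variables. *)
Lemma monomial_rowspace (R : realFieldType) (m n k : nat)
    (c : 'I_m -> 'I_n.+1 -> R) :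
  exists (A : 'M[R]_('C(k + n, k), m)), forall t : 'I_n.+1 -> R,
    (\row_i (\sum_j t j * c i j) ^+ k <= A)%MS.
Proof.
pose S := [set s : k.-tuple 'I_n.+1 | sorted leq (map val s)]%SET.
rewrite -(card_sorted_tuples k n) -/S.
pose mon (s : k.-tuple 'I_n.+1) : 'rV[R]_m := \row_i \prod_(j <- s) c i j.
exists (\matrix_(l < #|S|) mon (enum_val l)) => t.
have srt_tot : total (fun x y : 'I_n.+1 => (x <= y)%N).
  by move=> x y; exact: leq_total.
have -> : \row_i (\sum_j t j * c i j) ^+ k =
    \sum_(s : k.-tuple 'I_n.+1) (\prod_(j <- s) t j) *: mon s.
  apply/rowP => i; rewrite mxE summxE.
  have -> : (\sum_j t j * c i j) ^+ k = \prod_(a < k) \sum_j t j * c i j.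
    by rewrite prodr_const card_ord.
  rewrite (bigA_distr_bigA (fun (_ : 'I_k) j => t j * c i j)) /=.
  rewrite (reindex (fun s : k.-tuple 'I_n.+1 =>
    [ffun a => tnth s a])) /=; last first.
    exists (fun f : {ffun 'I_k -> 'I_n.+1} => [tuple f a | a < k]) => /= x _.
      by apply: eq_from_tnth => a; rewrite tnth_mktuple ffunE.
    by apply/ffunP => a; rewrite ffunE tnth_mktuple.
  apply: eq_bigr => s _; rewrite !mxE -big_split /= big_tuple.
  by apply: eq_bigr => a _; rewrite ffunE.
apply: summx_sub => s _; apply: scalemx_sub.
pose s' : k.-tuple 'I_n.+1 :=
  [tuple of sort (fun x y : 'I_n.+1 => (x <= y)%N) s].
(* A monomial does not depend on the order of its factors. *)
have -> : mon s = mon s'.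
  apply/rowP => i; rewrite !mxE; apply: perm_big.
  by rewrite perm_sym; exact: permEl (perm_sort _ _).
have s'S : s' \in S.
  by rewrite inE /= sorted_map; exact: sort_sorted.
have -> : mon s' =
    row (enum_rank_in s'S s') (\matrix_(l < #|S|) mon (enum_val l)).
  by rewrite rowK enum_rankK_in.
exact: row_sub.
Qed.

(** There are n variables here, and one dummy coordinate, always zero, is added.
    The resulting 'C(n + k, k) is at least the number of monomials of degree k
    in n variables, and n = 0 needs no separate treatment. *)
Lemma power_leverage (R : rcfType) (m n k : nat) (c : 'I_m -> 'I_n -> R)
    (w : 'I_m -> R) :
  (forall i, 0 <= w i) ->
  exists K : 'I_m -> R, (forall i, 0 <= K i) /\ \sum_i K i <= 'C(n + k, k)%:R /\
    forall (t : 'I_n -> R) i,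
      w i * (\sum_j t j * c i j) ^+ (2 * k) <=
      K i * \sum_l w l * (\sum_j t j * c l j) ^+ (2 * k).
Proof.
move=> w0.
pose pad (d : 'I_n -> R) (j : 'I_n.+1) := oapp d 0 (unlift ord0 j).
have [A subA] := @monomial_rowspace R m n k (fun i => pad (c i)).
pose D := diag_mx (\row_i Num.sqrt (w i)).
have [K [K0 [Ksum Kle]]] := rowspace_leverage (A *m D).
exists K; split=> //; split; first by rewrite addnC.
move=> t i; have := Kle _ (submxMr D (subA (pad t))).
have coef l : ((\row_i (\sum_j pad t j * pad (c i) j) ^+ k) *m D) 0 l ^+ 2 =
    w l * (\sum_j t j * c l j) ^+ (2 * k).
  rewrite mul_mx_diag !mxE big_ord_recl {1}/pad unlift_none mul0r add0r.
  rewrite exprMn sqr_sqrtr// mulrC -exprM (mulnC k); congr (_ * _ ^+ _).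
  by apply: eq_bigr => j _; rewrite /pad liftK.
by move=> /(_ i); rewrite coef (eq_bigr _ (fun l _ => coef l)).
Qed.

(** * Numerical inequalities *)

(** Hoelder's inequality for the exponents p / (p - q) and p / q; for p = q the
    factors of exponent 0 are 1, including 0 `^ 0. *)
Lemma sum_hoelder (R : realType) (m : nat) (p q : R) (a b : 'I_m -> R) :
  0 < q -> q <= p -> (forall i, 0 <= a i) -> (forall i, 0 <= b i) ->
  \sum_i a i `^ (p - q) * b i `^ q <=
  (\sum_i a i `^ p) `^ (1 - q / p) * (\sum_i b i `^ p) `^ (q / p).
Proof.
move=> q0; rewrite le_eqVlt => /predU1P[<-|qp] a0 b0.
  rewrite divff ?gt_eqF// !subrr !powRr0 mul1r powRr1; last first.
    by apply: sumr_ge0 => i _; exact: powR_ge0.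
  by apply: ler_sum => i _; rewrite powRr0 mul1r.
have p0 : 0 < p := lt_trans q0 qp.
have pq0 : 0 < p - q by rewrite subr_gt0.
move AE : (\sum_i a i `^ p) => A; move BE : (\sum_i b i `^ p) => B.
have A0 : 0 <= A by rewrite -AE; apply: sumr_ge0 => i _; exact: powR_ge0.
have B0 : 0 <= B by rewrite -BE; apply: sumr_ge0 => i _; exact: powR_ge0.
have [A_eq0|A_neq0] := eqVneq A 0.
  rewrite big1 ?mulr_ge0 ?powR_ge0// => i _.
  suff -> : a i = 0 by rewrite powR0 ?gt_eqF// mul0r.
  apply: (@powR_eq0_eq0 _ _ p).
  by apply: (psumr_eq0P _ (etrans AE A_eq0)) => // j _; exact: powR_ge0.
have [B_eq0|B_neq0] := eqVneq B 0.
  rewrite big1 ?mulr_ge0 ?powR_ge0// => i _.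
  suff -> : b i = 0 by rewrite (@powR0 _ q) ?gt_eqF// mulr0.
  apply: (@powR_eq0_eq0 _ _ p).
  by apply: (psumr_eq0P _ (etrans BE B_eq0)) => // j _; exact: powR_ge0.
have {}A0 : 0 < A by rewrite lt_def A_neq0.
have {}B0 : 0 < B by rewrite lt_def B_neq0.
have A'0 : 0 < A `^ (1 - q / p) by exact: powR_gt0.
have B'0 : 0 < B `^ (q / p) by exact: powR_gt0.
rewrite -[leRHS]mul1r -ler_pdivrMr ?mulr_gt0// mulr_suml.
apply: (@le_trans _ _
    (\sum_i ((1 - q / p) * (a i `^ p / A) + q / p * (b i `^ p / B))));
  last first.
  by rewrite big_split -!mulr_sumr -!mulr_suml AE BE !divff// !mulr1 /= subrK.
apply: ler_sum => i _.
have -> : 1 - q / p = (p / (p - q))^-1 by field; rewrite !gt_eqF.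
have -> : q / p = (p / q)^-1 by field; rewrite !gt_eqF.
set P := p / (p - q); set Q := p / q.
have P0 : 0 < P by rewrite divr_gt0.
have Q0 : 0 < Q by rewrite divr_gt0.
have -> : a i `^ (p - q) * b i `^ q / (A `^ P^-1 * B `^ Q^-1) =
    (a i `^ (p - q) / A `^ P^-1) * (b i `^ q / B `^ Q^-1).
  by rewrite invfM; ring.
apply: (le_trans (@conjugate_powR _ _ _ P Q _ _ P0 Q0 _)).
- by rewrite divr_ge0 ?powR_ge0.
- by rewrite divr_ge0 ?powR_ge0.
- by rewrite /P /Q; field; rewrite !gt_eqF.
have powRVK (x r : R) : 0 < x -> 0 < r -> (x `^ r^-1)^-1 `^ r = x^-1.
  move=> x0 r0; rewrite -powR_inv1 ?powR_ge0// powRAC -(powRrM x).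
  rewrite mulVf ?gt_eqF//.
  by rewrite powRr1 ?(ltW x0)// powR_inv1// ltW.
rewrite !powRM ?invr_ge0 ?powR_ge0// !powRVK// -!powRrM.
rewrite (_ : (p - q) * P = p); last by rewrite /P; field; rewrite gt_eqF.
rewrite (_ : q * Q = p); last by rewrite /Q; field; rewrite gt_eqF.
by rewrite mulrC lerD2l mulrC.
Qed.

(** Combines 'C(n + k, k) <= (n + k)^k / k! with k^k / k! <= e^k, one term of
    the exponential series. *)
Lemma binomial_expR_le (R : realType) (n k : nat) : (0 < k)%N ->
  'C(n + k, k)%:R <= (expR 1 * (n + k)%:R / k%:R) ^+ k :> R.
Proof.
move=> k0.
have ffact_le N l : (N ^_ l <= N ^ l)%N.
  rewrite ffact_prod -[in leqRHS](card_ord l) -prod_nat_const.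
  by apply: leq_prod => i _; exact: leq_subr.
have kf : (0 : R) < k`!%:R by rewrite ltr0n fact_gt0.
have kk : (0 : R) < k%:R by rewrite ltr0n.
have -> : 'C(n + k, k)%:R = ((n + k) ^_ k)%:R / k`!%:R :> R.
  by rewrite -bin_ffact natrM mulfK// gt_eqF.
apply: (@le_trans _ _ ((n + k)%:R ^+ k / k`!%:R)).
  by rewrite ler_pM2r ?invr_gt0// -natrX ler_nat.
have -> : (expR 1 * (n + k)%:R / k%:R) ^+ k =
    (n + k)%:R ^+ k * (expR k%:R / k%:R ^+ k) :> R.
  rewrite !exprMn exprVn -expRM_natl mulr1; ring.
rewrite ler_wpM2l ?exprn_ge0// ler_pdivlMr ?exprn_gt0// mulrC.
have := @expR_ge1Dxn R k%:R k.-1 (ltW kk); rewrite prednK//.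
by apply: le_trans; rewrite lerDr.
Qed.

(** * Norming functionals of a finite rank operator *)

(** Finite-dimensional Hahn-Banach theorem, in coordinates: t_j is the value at
    v_j of a functional of norm at most 1 on the span of the v_j that norms v_0.
    The v_j need not be linearly independent, as the inequality forces the
    values t_j to respect every linear relation. *)
Lemma norming_family (R : realType) (W : normedModType R) (v : nat -> W)
    (n : nat) :
  exists t : nat -> R, t 0%N = `|v 0%N| /\
    forall c : nat -> R,
      `|\sum_(j < n.+1) c j * t j| <= `|\sum_(j < n.+1) c j *: v j|.
Proof.
elim: n => [|n [t [t0 tle]]].
  exists (fun=> `|v 0%N|); split=> // c.
  by rewrite !big_ord1 normrM normr_id normrZ.
pose f (c : nat -> R) := \sum_(j < n.+1) c j * t j.
pose g (c : nat -> R) := \sum_(j < n.+1) c j *: v j.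
have f_le c : `|f c| <= `|g c| by exact: tle.
have fD c d : f c + f d = f (fun j => c j + d j).
  by rewrite /f -big_split; apply: eq_bigr => j _; rewrite mulrDl.
have gD c d : g c + g d = g (fun j => c j + d j).
  by rewrite /g -big_split; apply: eq_bigr => j _; rewrite scalerDl.
have fZ a c : a * f c = f (fun j => a * c j).
  by rewrite /f mulr_sumr; apply: eq_bigr => j _; rewrite mulrA.
have gZ a c : a *: g c = g (fun j => a * c j).
  by rewrite /g scaler_sumr; apply: eq_bigr => j _; rewrite scalerA.
(* The value s at the new vector w must satisfy
   f c - |g c - w| <= s <= |g d + w| - f d for all c and d. *)
pose w := v n.+1.
pose E := [set f c - `|g c - w| | c in [set: nat -> R]].
have ubE d : ubound E (`|g d + w| - f d).
  move=> _ [c _ <-]; rewrite lerBrDr addrAC lerBlDr fD.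
  apply: (le_trans (ler_norm _)); apply: (le_trans (f_le _)).
  rewrite -gD (_ : g c + g d = (g d + w) + (g c - w)); first exact: ler_normD.
  by rewrite addrACA subrr addr0 addrC.
pose s := sup E.
have Esup : has_sup E.
  split; first by exists (f (fun=> 0) - `|g (fun=> 0) - w|); exists (fun=> 0).
  by exists (`|g (fun=> 0) + w| - f (fun=> 0)); exact: ubE.
have s_le d : f d + s <= `|g d + w|.
  by rewrite addrC -lerBrDr; apply: ge_sup (ubE d); case: Esup.
have s_ge d : f d - s <= `|g d - w|.
  rewrite lerBlDr -lerBlDl; apply: ub_le_sup; first by case: Esup.
  by exists d.
have main c a : f c + a * s <= `|g c + a *: w|.
  have [a0|a0|->] := ltrgt0P a.
  - have -> : g c + a *: w = a *: (g (fun j => a^-1 * c j) + w).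
      by rewrite scalerDr -gZ scalerA divff ?gt_eqF// scale1r.
    have -> : f c + a * s = a * (f (fun j => a^-1 * c j) + s).
      by rewrite mulrDr -fZ mulVKf ?gt_eqF.
    by rewrite normrZ gtr0_norm// ler_pM2l.
  - have -> : g c + a *: w = (- a) *: (g (fun j => (- a)^-1 * c j) - w).
      rewrite scalerBr -gZ scalerA divff ?oppr_eq0 ?lt_eqF// scale1r.
      by rewrite scaleNr opprK.
    have -> : f c + a * s = (- a) * (f (fun j => (- a)^-1 * c j) - s).
      by rewrite mulrBr -fZ mulVKf ?oppr_eq0 ?lt_eqF// mulNr opprK.
    by rewrite normrZ gtr0_norm ?oppr_gt0// ler_pM2l ?oppr_gt0.
  - by rewrite mul0r scale0r !addr0; apply: le_trans (f_le _); exact: ler_norm.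
exists (fun j => if j == n.+1 then s else t j); split=> // c.
rewrite big_ord_recr [leRHS](_ : _ = `|g c + c n.+1 *: w|); last first.
  by rewrite big_ord_recr.
rewrite /= eqxx (_ : \sum_(j < n.+1) _ = f c); last first.
  by apply: eq_bigr => j _; rewrite ltn_eqF.
rewrite ler_norml main andbT lerNl opprD -mulrN1 -mulrN.
have := main (fun j => - 1 * c j) (- c n.+1).
rewrite -fZ -gZ !mulN1r scaleN1r scaleNr -opprD normrN.
by rewrite mulrN1 mulrN mulNr.
Qed.

(** Coordinates co of T x in a basis v of the range of T. *)
Lemma finite_rank_factor (R : realType) (V W : lmodType R)
    (T : {linear V -> W}) (n : nat) : has_dim (range T) n ->
  exists (v : 'I_n -> W) (co : V -> 'I_n -> R),
    (forall a x y j, co (a *: x + y) j = a * co x j + co y j) /\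
    forall x, T x = \sum_j co x j *: v j.
Proof.
move=> [v [v_indep v_span]].
have /choice[co coE] x : exists c : 'I_n -> R, \sum_j c j *: v j = T x.
  have : lin_span v (T x) by rewrite v_span; exists x.
  by move=> [c _ cE]; exists c.
exists v, co; split=> // a x y j; apply/eqP; rewrite -subr_eq0; apply/eqP.
apply: (v_indep (fun j => co (a *: x + y) j - (a * co x j + co y j))).
under eq_bigr do rewrite scalerBl scalerDl -scalerA.
by rewrite sumrB big_split/= -scaler_sumr !coE linearP subrr.
Qed.

(** The functionals x |-> g (T x) that norm T at a given point are all linear
    forms in the same n coordinates. *)
Lemma finite_rank_norming (R : realType) (V W : normedModType R)
    (T : {linear V -> W}) (n : nat) : has_dim (range T) n ->
  exists co : V -> 'I_n -> R, forall x0,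
    exists (t : 'I_n -> R) (f : {linear V -> R^o}),
    [/\ forall x, f x = \sum_j t j * co x j, f x0 = `|T x0| &
        forall x, `|f x| <= `|T x|].
Proof.
move=> /finite_rank_factor[v [co [co_lin TE]]]; exists co => x0.
(* The family given to [norming_family] is T x0 followed by the basis v. *)
pose ext (A : nmodType) (a : A) (c : 'I_n -> A) (j : nat) :=
  if j is i.+1 then oapp c 0 (insub i) else a.
have extS (A : nmodType) (a : A) (c : 'I_n -> A) (j : 'I_n) :
    ext A a c (lift ord0 j) = c j.
  by rewrite lift0 /= valK.
have [t [t0 tle]] := norming_family (ext _ (T x0) v) n.
have {}tle (a : R) (c : 'I_n -> R) : `|a * t 0%N + \sum_(j < n) c j * t j.+1| <=
    `|a *: T x0 + \sum_j c j *: v j|.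
  have := tle (ext _ a c); rewrite !big_ord_recl.
  under eq_bigr do rewrite extS lift0.
  by under [in leRHS]eq_bigr do rewrite !extS.
pose f0 (x : V) : R^o := \sum_(j < n) t j.+1 * co x j.
have f0_lin : linear f0.
  move=> a x y; rewrite /f0 scaler_sumr -big_split; apply: eq_bigr => j _ /=.
  rewrite co_lin mulrDr; congr (_ + _); exact: mulrCA.
pose f : {linear V -> R^o} :=
  HB.pack f0 (GRing.isLinear.Build R V R^o *:%R f0 f0_lin).
have f0E x : f0 x = \sum_(j < n) co x j * t j.+1.
  by apply: eq_bigr => j _; exact: mulrC.
exists (fun j : 'I_n => t j.+1), f; split=> //.
(* The combination - T x0 + \sum_j co x0 j *: v j vanishes. *)
- have := tle (- 1) (co x0).
  rewrite scaleN1r -TE addNr normr0 normr_le0 mulN1r addrC subr_eq0 -f0E t0.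
  by move/eqP.
- by move=> x; have := tle 0 (co x); rewrite mul0r scale0r !add0r -TE -f0E.
Qed.

(** * The summing norm *)

Lemma lp_normZ (R : realType) (W : normedModType R) (p a : R) (m : nat)
    (y : 'I_m -> W) : 0 < p -> 0 <= a ->
  lp_norm p (fun i => a *: y i) = a * lp_norm p y.
Proof.
move=> p0 a0; rewrite /lp_norm.
under eq_bigr do rewrite normrZ ger0_norm// powRM//.
rewrite -mulr_sumr powRM ?powR_ge0//; last first.
  by apply: sumr_ge0 => i _; exact: powR_ge0.
by rewrite -powRrM divff ?gt_eqF// powRr1.
Qed.

(** The estimate of the summing norm for a fixed family (x_i), with M a bound on
    its weak l_p norm and L > 0 a bound on the operator norm of T. *)
Lemma lp_norm_finite_rank_le (R : realType) (V W : normedModType R)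
    (T : {linear V -> W}) (n : nat) (p L M : R) (m : nat) (x : 'I_m -> V) :
  has_dim (range T) n -> 2 <= p -> 0 < L -> 0 <= M ->
  (forall y, `|T y| <= L * `|y|) ->
  (forall f : {linear V -> R^o}, (forall y, `|f y| <= `|y|) ->
    lp_norm p (fun i => f (x i)) <= M) ->
  lp_norm p (fun i => T (x i)) <=
    2 * Num.sqrt (expR 1) * Num.sqrt ((n%:R + p) / p) * L * M.
Proof.
move=> /finite_rank_norming[co coP] p2 L0 M0 T_le M_ge.
have p0 : 0 < p by lra.
pose k := Num.truncn (p / 2).
have /andP[kp pk] : k%:R <= p / 2 < k.+1%:R by apply: truncn_itv; lra.
have k0 : (0 < k)%N by rewrite truncn_gt_nat; lra.
have k1 : (1 : R) <= k%:R by rewrite ler1n.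
pose q : R := (2 * k)%:R.
have qE : q = 2 * k%:R by rewrite /q natrM.
have q0 : 0 < q by rewrite qE; lra.
have qp : q <= p by rewrite qE; lra.
have p4k : p <= 4 * k%:R by move: pk; rewrite -(natr1 k); lra.
set C := 2 * _ * _.
have C0 : 0 <= C by rewrite !mulr_ge0// sqrtr_ge0.
have D_le : 'C(n + k, k)%:R <= C ^+ (2 * k).
  apply: (le_trans (binomial_expR_le R n k0)); rewrite exprM.
  have np0 : 0 <= (n%:R + p) / p by rewrite divr_ge0 ?addr_ge0 ?ler0n ?(ltW p0).
  apply: lerXn2r; rewrite ?nnegrE ?sqr_ge0 ?divr_ge0 ?mulr_ge0 ?expR_ge0//.
  have -> : C ^+ 2 = expR 1 * (4 * ((n%:R + p) / p)).
    by rewrite /C !exprMn !sqr_sqrtr ?expR_ge0//; ring.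
  rewrite -mulrA ler_wpM2l ?expR_ge0// ler_pdivrMr; last by lra.
  rewrite (_ : 4 * _ * _ = 4 * (n%:R + p) * k%:R / p); last by ring.
  rewrite ler_pdivlMr// natrD; have n0 : (0 : R) <= n%:R by exact: ler0n.
  (* (n + k) p <= 4 (n + p) k, since p <= 4 k. *)
  nra.
pose w i := `|T (x i)| `^ (p - q).
have [K [K0 [Ksum K_le]]] :=
  @power_leverage R m n k (fun i => co (x i)) w (fun i => powR_ge0 _ _).
rewrite /lp_norm; move SE : (\sum_(i < m) `|T (x i)| `^ p) => S.
have S0 : 0 <= S by rewrite -SE; apply: sumr_ge0 => i _; exact: powR_ge0.
have Si i : `|T (x i)| `^ p <= K i * (S `^ (1 - q / p) * (L * M) ^+ (2 * k)).
  have [t [f [fE fi f_le]]] := coP (x i).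
  have := K_le t i; rewrite -fE fi.
  rewrite {1}/w -(powR_mulrn (2 * k) (normr_ge0 (T (x i)))) -/q.
  rewrite -powRD ?subrK; last by rewrite gt_eqF.
  move/le_trans; apply; rewrite ler_wpM2l//.
  have -> : \sum_l w l * (\sum_j t j * co (x l) j) ^+ (2 * k) =
      \sum_l `|T (x l)| `^ (p - q) * `|f (x l)| `^ q.
    apply: eq_bigr => l _; rewrite -fE /q powR_mulrn//; congr (_ * _).
    by rewrite !exprM real_normK// num_real.
  apply: (le_trans (sum_hoelder q0 qp _ _)) => //; rewrite SE.
  rewrite ler_wpM2l ?powR_ge0// mulrC powRrM -/(lp_norm p (fun i => f (x i))).
  rewrite /q powR_mulrn ?powR_ge0//.
  rewrite lerXn2r ?nnegrE ?powR_ge0 ?mulr_ge0 ?(ltW L0)//.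
  rewrite mulrC -ler_pdivrMr// mulrC -lp_normZ ?invr_ge0 ?(ltW L0)//.
  (* f is bounded by L in norm, so that f / L lies in the unit ball. *)
  apply: (M_ge (L^-1 \*: f)) => y /=.
  rewrite normrZ ger0_norm ?invr_ge0 ?(ltW L0)// mulrC ler_pdivrMr// mulrC.
  exact: le_trans (f_le y) (T_le y).
have S_le : S <= C ^+ (2 * k) * (S `^ (1 - q / p) * (L * M) ^+ (2 * k)).
  apply: (@le_trans _ _
      ((\sum_i K i) * (S `^ (1 - q / p) * (L * M) ^+ (2 * k)))).
    by rewrite -[leLHS]SE mulr_suml; apply: ler_sum => i _; exact: Si.
  rewrite ler_wpM2r ?mulr_ge0 ?powR_ge0 ?exprn_ge0 ?mulr_ge0 ?(ltW L0)//.
  exact: le_trans Ksum D_le.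
have CLM0 : 0 <= C * L * M by rewrite !mulr_ge0// ltW.
have [->|S_neq0] := eqVneq S 0; first by rewrite powR0 ?invr_eq0 ?gt_eqF.
have {}S0 : 0 < S by rewrite lt_def S_neq0.
(* Compare the (2k)-th powers and multiply by S^(1 - q/p), so that S appears. *)
rewrite -(@ler_pXn2r _ (2 * k)) ?muln_gt0// ?nnegrE ?powR_ge0//.
rewrite -powR_mulrn ?powR_ge0// -powRrM mulrC -/q.
rewrite -mulrA exprMn -(ler_pM2l (powR_gt0 (1 - q / p) S0)).
rewrite -powRD ?S_neq0 ?implybT// subrK powRr1 ?(ltW S0)//.
by rewrite mulrCA.
Qed.

Lemma opnorm_fin (R : realType) (V W : normedModType R) (T : {linear V -> W}) :
  bounded_fun_norm T -> exists L : R, [/\ opnorm T = L%:E, 0 <= L &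
    forall y, `|T y| <= L * `|y|].
Proof.
move=> /(_ 1)[M M_ge].
have T_ub y : `|y| <= 1 -> (`|T y|%:E <= opnorm T)%E.
  by move=> y1; apply: ereal_sup_ubound; exists y.
have T_ge0 : (0 <= opnorm T)%E.
  by have := T_ub 0; rewrite linear0 !normr0; apply; exact: ler01.
have T_leM : (opnorm T <= M%:E)%E.
  by apply: ge_ereal_sup => _ [y y1 <-]; rewrite lee_fin; exact: M_ge.
have T_fin : opnorm T \is a fin_num.
  by rewrite ge0_fin_numE//; exact: le_lt_trans T_leM (ltry _).
exists (fine (opnorm T)); split; [by rewrite fineK|exact: fine_ge0|move=> y].
have [->|y0] := eqVneq y 0; first by rewrite linear0 !normr0 mulr0.
have ny0 : 0 < `|y| by rewrite normr_gt0.
have := T_ub (`|y|^-1 *: y); rewrite normrZ normfV normr_id mulVf ?gt_eqF//.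
move=> /(_ (lexx _)); rewrite -(fineK T_fin) lee_fin linearZ normrZ normfV.
by rewrite normr_id mulrC ler_pdivrMr.
Qed.

Theorem corollary10 (R : realType) (F1 F2 : completeNormedModType R) (p : R)
    (T : {linear F1 -> F2}) (hp : 2 <= p) (Tbounded : bounded_fun_norm T)
    (Tfin : finite_rank T) :
  (summing_norm p T <=
     (2 * Num.sqrt (expR 1) * Num.sqrt (((rk T)%:R + p) / p))%:E * opnorm T)%E.
Proof.
have T_dim : has_dim (range T) (rk T) by exact: getPex Tfin.
have [L [-> L0 T_le]] := opnorm_fin Tbounded.
have p0 : 0 < p by lra.
set C := 2 * _ * _.
have C0 : 0 < C.
  by rewrite !mulr_gt0 ?sqrtr_gt0 ?expR_gt0// divr_gt0// ltr_wpDl.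
rewrite -EFinM; apply: ereal_inf_lbound; exists (C * L) => //; split.
  by rewrite mulr_ge0// ltW.
move=> m x _.
have in_ball (f : {linear F1 -> R^o}) :
    (forall y, `|f y| <= `|y|) -> dual_unit_ball f.
  move=> f_le; split.
    by move=> r; exists r => y; exact: le_trans (f_le y).
  apply: ge_ereal_sup => _ [y y1 <-]; rewrite lee_fin.
  exact: le_trans (f_le y) y1.
have W_ge f : dual_unit_ball f ->
    ((lp_norm p (fun i => f (x i)))%:E <= weak_lp_norm p x)%E.
  by move=> fB; apply: ereal_sup_ubound; exists f.
have W0 : (0 <= weak_lp_norm p x)%E.
  apply: le_trans (W_ge (\0 : {linear F1 -> R^o}) _).
    by rewrite lee_fin; exact: powR_ge0.
  by apply: in_ball => y; rewrite normr0.
(* A weak norm equal to +oo makes the bound trivial, except for L = 0. *)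
have [L_eq0|L_neq0] := eqVneq L 0.
  rewrite /lp_norm big1 ?powR0 ?invr_eq0 ?gt_eqF// => [|i _].
    by rewrite mule_ge0// lee_fin mulr_ge0// ltW.
  have := T_le (x i); rewrite L_eq0 mul0r normr_le0 => /eqP ->.
  by rewrite normr0 powR0// gt_eqF.
have {}L0 : 0 < L by rewrite lt_def L_neq0.
case: (weak_lp_norm p x) W_ge W0 => [M||//] W_ge W0; last first.
  by rewrite gt0_muley ?leey// lte_fin mulr_gt0.
rewrite -EFinM lee_fin; apply: lp_norm_finite_rank_le => // f f_le.
by rewrite -lee_fin; apply: W_ge; exact: in_ball.
Qed.
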